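(* Let $d\ge1$. Let $\mathcal{Z}_d\subset\mathbb{R}^{d+1}$ be the convex hull of the coefficient vectors $(h_0,\dots,h_d)$ of the Ehrhart $h^\ast$-polynomials of all $d$-dimensional lattice zonotopes in $\mathbb{R}^d$, and let $\mathcal{P}_d$ be the analogous convex hull over all $d$-dimensional lattice parallelepipeds in $\mathbb{R}^d$. Then \[\mathcal{Z}_d=\mathcal{P}_d=A_1(d+1)+\mathbb{R}_{\ge0}A_2(d+1)+\cdots+\mathbb{R}_{\ge0}A_{d+1}(d+1),\] and this set is a $d$-dimensional simplicial cone (i.e. $A_1(d+1),\dots,A_{d+1}(d+1)$ are linearly independent).
   Context: For a $d$-dimensional lattice polytope $P\subset\mathbb{R}^d$ (vertices in $\mathbb{Z}^d$), its Ehrhart $h^\ast$-polynomial $h_0+h_1t+\cdots+h_dt^d$ is defined by $\sum_{n\ge0}|nP\cap\mathbb{Z}^d|t^n=(h_0+\cdots+h_dt^d)/(1-t)^{d+1}$. A lattice zonotope is a set $\{\sum_{i=1}^n\lambda_iv_i:0\le\lambda_i\le1\}$ with $v_i\in\mathbb{Z}^d$, up to integer translation; a lattice parallelepiped is such a zonotope with $v_1,\dots,v_n$ linearly independent. For a permutation $\sigma=\sigma_1\cdots\sigma_m\in S_m$ let $\operatorname{des}(\sigma)=|\{i\in[m-1]:\sigma_i>\sigma_{i+1}\}|$. For $1\le j\le m$, the $(A,j)$-Eulerian polynomial is $A_j(m,t)=\sum_{\sigma\in S_m,\ \sigma_m=m+1-j}t^{\operatorname{des}(\sigma)}$. $A_j(d+1)\in\mathbb{R}^{d+1}$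 denotes the coefficient vector of $A_j(d+1,t)$ (coefficients of $t^0,\dots,t^d$). *)

(* Defs.v *)
From HB Require Import structures.
From mathcomp Require Import all_boot all_order all_algebra all_fingroup.
From mathcomp Require Import finmap.
From mathcomp Require Import boolp classical_sets cardinality reals convex.

Set Implicit Arguments.
Unset Strict Implicit.
Unset Printing Implicit Defensive.

Import Order.TTheory GRing.Theory Num.Theory.

Local Open Scope classical_set_scope.
Local Open Scope ring_scope.

Section Polytopes.
Variables (R : realType) (d : nat).
Implicit Types P : set 'rV[R]_d.

Definition affine_hull P : set 'rV[R]_d :=
  [set x | exists (n : nat) (a : 'I_n -> R) (p : 'I_n -> 'rV[R]_d),
     [/\ forall i, P (p i), \sum_(i < n) a i = 1 &
         x = \sum_(i < n) a i *: p i]].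

(* The affine hull of P is a translate of a linear subspace (the row space
   of U) of dimension k. *)
Definition has_dim P (k : nat) : Prop :=
  exists (x0 : 'rV[R]_d) (U : 'M[R]_d),
    \rank U = k /\
    affine_hull P = [set x0 + u | u in [set u : 'rV[R]_d | (u <= U)%MS]].

Definition int_lattice : set 'rV[R]_d :=
  range (fun w : 'rV[int]_d => map_mx intr w).

Definition dilate (n : nat) P : set 'rV[R]_d := [set n%:R *: x | x in P].

(* Only used for bounded P: fset_set is empty on infinite sets. *)
Definition ehrhart P (n : nat) : nat :=
  #|` fset_set (dilate n P `&` int_lattice)|.

(* h = (h_0, ..., h_d) satisfies
     (1 - t)^(d+1) * \sum_n (ehrhart P n) t^n = h_0 + h_1 t + ... + h_d t^d
   as formal power series: the coefficients of t^n agree for all n, including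
   n > d, where the right-hand side has coefficient 0. *)
Definition is_hstar P (h : 'rV[R]_d.+1) : Prop :=
  forall n : nat,
    \sum_(i < n.+1) ((1 - 'X) ^+ d.+1 : {poly R})`_i * (ehrhart P (n - i))%:R
    = (rVpoly h)`_n.

(* The generators v_1, ..., v_n are the rows of v; w is the translation. *)
Definition zonotope (n : nat) (v : 'M[int]_(n, d)) (w : 'rV[int]_d) :
    set 'rV[R]_d :=
  [set map_mx intr w + \sum_(i < n) l i *: map_mx intr (row i v)
    | l in [set l : 'I_n -> R | forall i, 0 <= l i <= 1]].

Definition lattice_zonotope P : Prop :=
  exists (n : nat) (v : 'M[int]_(n, d)) (w : 'rV[int]_d), P = zonotope v w.

Definition lattice_parallelepiped P : Prop :=
  exists (n : nat) (v : 'M[int]_(n, d)) (w : 'rV[int]_d),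
    row_free (map_mx intr v : 'M[R]_(n, d)) /\ P = zonotope v w.

Definition convex_hull (k : nat) (S : set 'rV[R]_k) : set 'rV[R]_k :=
  smallest (fun A : set 'rV[R]_k => convex_set A) S.

Definition hstar_hull (C : set 'rV[R]_d -> Prop) : set 'rV[R]_d.+1 :=
  convex_hull [set h | exists P, [/\ C P, has_dim P d & is_hstar P h]].

End Polytopes.

Definition des (m : nat) (s : 'S_m.+1) : nat :=
  #|[pred i : 'I_m | (s (lift ord0 i) < s (widen_ord (leqnSn m) i))%N]|.

(* The polynomial A_j(m+1, t). Permutations act on {0, ..., m}, so the last
   letter in one-line notation on {1, ..., m+1} is (s ord_max).+1. *)
Definition eulerianA (R : realType) (m j : nat) : {poly R} :=
  \sum_(s : 'S_m.+1 | ((s ord_max).+1 == m.+1 + 1 - j)%N) 'X^(des s).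

(* The coefficients of t^0, ..., t^d in A_j(d+1, t). *)
Definition eulerian_vec (R : realType) (d j : nat) : 'rV[R]_d.+1 :=
  \row_(i < d.+1) (eulerianA R d j)`_i.

Definition cone_at (R : realType) (k n : nat) (a : 'rV[R]_n)
    (g : 'I_k -> 'rV[R]_n) : set 'rV[R]_n :=
  [set a + \sum_(i < k) c i *: g i
    | c in [set c : 'I_k -> R | forall i, 0 <= c i]].

Definition simplicial_cone (R : realType) (k n : nat) (C : set 'rV[R]_n) :
    Prop :=
  exists (a : 'rV[R]_n) (g : 'I_k -> 'rV[R]_n),
    row_free (\matrix_(i < k) g i) /\ C = cone_at a g.

(* Main.v *)
(** The series with coefficients n^i (n+1)^(d-i) has numerator A_(i+1)(d+1, t)
    over (1-t)^(d+1): removing the last letter of a permutation and taking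
    differences in n give the same recurrence. Hence the coordinates of h* in
    the basis A_1, ..., A_(d+1) are those of the Ehrhart polynomial in the basis
    n^i (n+1)^(d-i), and evaluating at n = 0 shows that the first one is 1.
    For a parallelepiped, the i-th coordinate counts the lattice points of the
    half-open parallelepiped with exactly i nonzero coordinates. A zonotope with
    linearly dependent generators has a generator v, g times a primitive vector,
    whose deletion stays full-dimensional, and
      ehr_Z(n) = ehr_(Z without v)(n) + g n ehr_(Z/v)(n),
    so nonnegativity follows by induction on the number of generators.
    Conversely, suitable parallelepipeds realise A_1 + N A_(j+1) for all N. *)
Require Import Defs.
From HB Require Import structures.
From mathcomp Require Import all_boot all_order all_algebra all_fingroup.
From mathcomp Require Import finmap zify ring lra interval_inference.
From mathcomp Require Import boolp classical_sets cardinality reals convex.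

Set Implicit Arguments.
Unset Strict Implicit.
Unset Printing Implicit Defensive.

Import Order.TTheory GRing.Theory Num.Theory.

Local Open Scope classical_set_scope.
Local Open Scope ring_scope.

(** * Multiplication of power series by polynomials *)

Section PowerSeries.
Variable R : realType.
Implicit Types (p q : {poly R}) (f g : nat -> R).

(* The coefficient of t^n in p(t) * \sum_n (f n) t^n. *)
Definition cauchy p f (n : nat) : R := \sum_(i < n.+1) p`_i * f (n - i)%N.

Lemma cauchy_trunc p f N n : (n <= N)%N ->
  cauchy p f n = (p * \poly_(i < N.+1) f i)`_n.
Proof.
move=> nN; rewrite coefM; apply: eq_bigr => i _.
by rewrite coef_poly ltnS (leq_trans (leq_subr _ _) nN).
Qed.

Lemma eq_cauchy p f g : f =1 g -> cauchy p f =1 cauchy p g.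
Proof. by move=> fg n; apply: eq_bigr => i _; rewrite fg. Qed.

Lemma cauchyM p q f n : cauchy (p * q) f n = cauchy p (cauchy q f) n.
Proof.
rewrite (@cauchy_trunc _ _ n)// -mulrA coefM; apply: eq_bigr => i _.
by rewrite (@cauchy_trunc _ _ n)// leq_subr.
Qed.

Lemma cauchy_sum (I : finType) p (F : I -> nat -> R) n :
  cauchy p (fun k => \sum_i F i k) n = \sum_i cauchy p (F i) n.
Proof.
rewrite /cauchy exchange_big /=; apply: eq_bigr => i _.
by rewrite big_distrr.
Qed.

Lemma cauchyZ p c f n : cauchy p (fun k => c * f k) n = c * cauchy p f n.
Proof.
by rewrite /cauchy big_distrr; apply: eq_bigr => i _ /=; rewrite mulrCA.
Qed.

Lemma cauchy1 f n : cauchy 1 f n = f n.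
Proof.
rewrite /cauchy big_ord_recl /= coef1 mul1r subn0 big1 ?addr0// => i _.
by rewrite coef1 /= mul0r.
Qed.

Lemma cauchyX f n : cauchy 'X f n = if n is k.+1 then f k else 0.
Proof.
rewrite (@cauchy_trunc _ _ n)// coefXM.
by case: n => //= n; rewrite coef_poly leqW.
Qed.

Lemma cauchyB1X f n : cauchy (1 - 'X) f n = f n - if n is k.+1 then f k else 0.
Proof.
rewrite (@cauchy_trunc _ _ n)// mulrBl coefB -!(@cauchy_trunc _ _ n)//.
by rewrite cauchy1 cauchyX.
Qed.

Lemma cauchyC p q f n : cauchy p (cauchy q f) n = cauchy q (cauchy p f) n.
Proof. by rewrite -!cauchyM mulrC. Qed.

(** A factor 1 - X takes differences of successive coefficients, the first one being kept; so it
    kills only the zero series. *)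
Lemma cauchy_B1X_inj k f : (forall n, cauchy ((1 - 'X) ^+ k) f n = 0) ->
  forall n, f n = 0.
Proof.
elim: k f => [|k IH] f H n; first by have := H n; rewrite cauchy1.
have {}H : forall n, cauchy (1 - 'X) f n = 0.
  by apply: IH => m; rewrite -cauchyM -exprSr.
elim: n => [|n IHn]; first by have := H 0%N; rewrite cauchyB1X subr0.
by have := H n.+1; rewrite cauchyB1X IHn subr0.
Qed.

End PowerSeries.

(** * Series with Eulerian numerators *)

Section Eulerian.
Variable R : realType.

(** Letters start at 0 here, so that A_j(m+1, t) is the case a = m + 1 - j. *)
Definition eulerian_last m a : {poly R} :=
  \sum_(s : 'S_m.+1 | s ord_max == a :> nat) 'X^(des s).

(** Appending the letter a raises the letters >= a by one. This keeps the old descents and creates a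
    final one exactly when the old last letter is raised above a. *)
Lemma des_lift_perm m (a : 'I_m.+2) (s : 'S_m.+1) :
  des (lift_perm ord_max a s) = ((a <= s ord_max)%N + des s)%N.
Proof.
have widenE (i : 'I_m.+1) : widen_ord (leqnSn m.+1) i = lift ord_max i.
  by apply: val_inj; rewrite /= /bump leqNgt ltn_ord.
rewrite /des -!sum1_card big_mkcond /= big_ord_recr /= addnC; congr (_ + _)%N.
  rewrite inE widenE lift_perm_lift.
  have -> : lift ord0 (ord_max : 'I_m.+1) = ord_max by apply: val_inj.
  rewrite lift_perm_id /= /bump.
  case: (leqP a (s ord_max)) => H; first by rewrite add1n ltnS H.
  by rewrite add0n ltnNge ltnW.
rewrite [RHS]big_mkcond; apply: eq_bigr => i _; rewrite !inE widenE.
have -> : lift ord0 (widen_ord (leqnSn m) i) = lift ord_max (lift ord0 i).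
  by apply: val_inj; rewrite /= /bump /= leqNgt [(_ < m.+1)%N]ltnS ltn_ord.
by rewrite !lift_perm_lift /= ltnNge leq_bump2 -ltnNge.
Qed.

Lemma lift_perm_surj n (i j : 'I_n.+1) (s : 'S_n.+1) : s i = j ->
  exists t : 'S_n, lift_perm i j t = s.
Proof.
move=> sij; pose f k := odflt k (unlift j (s (lift i k))).
have fE k : lift j (f k) = s (lift i k).
  have : j != s (lift i k) by rewrite -sij (inj_eq perm_inj) neq_lift.
  by rewrite /f => /unlift_some[l -> ->].
have f_inj : injective f.
  by move=> k l kl; have := fE k; rewrite kl fE => /perm_inj/lift_inj.
exists (perm f_inj); apply/permP => k; case: (unliftP i k) => [l|] ->.
  by rewrite lift_perm_lift permE fE.
by rewrite lift_perm_id.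
Qed.

Lemma lift_perm_inj n (i j : 'I_n.+1) : injective (lift_perm i j).
Proof.
move=> s t /permP st; apply/permP => k.
by have := st (lift i k); rewrite !lift_perm_lift => /lift_inj.
Qed.

(** Permutations are sorted by the last letter b that remains, after standardisation, once a is
    removed. *)
Lemma eulerian_lastS m a : (a <= m.+1)%N ->
  eulerian_last m.+1 a =
  \sum_(b < m.+1) 'X^(a <= b)%N * eulerian_last m b.
Proof.
rewrite -ltnS => am; rewrite /eulerian_last.
rewrite (reindex (lift_perm ord_max (Ordinal am))); last first.
  (* The default 1 is never taken on permutations ending in a. *)
  exists (fun s => odflt 1%g [pick t | lift_perm ord_max (Ordinal am) t == s]).
    by move=> t _; case: pickP => [t' /eqP/lift_perm_inj|/(_ t)]; rewrite ?eqxx.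
  move=> s /eqP sa; have [t ts] : exists t, lift_perm ord_max (Ordinal am) t = s.
    by apply: lift_perm_surj; apply: val_inj.
  by case: pickP => [t' /eqP|/(_ t)]; rewrite ?ts ?eqxx.
under eq_bigl do rewrite lift_perm_id eqxx.
under [RHS]eq_bigr do rewrite big_distrr.
rewrite (exchange_big_dep predT) //=; apply: eq_bigr => s _.
rewrite (big_pred1 (s ord_max)); first by rewrite des_lift_perm exprD.
by move=> b; rewrite /= eq_sym.
Qed.

Lemma eulerian_last0 : eulerian_last 0 0 = 1.
Proof.
rewrite /eulerian_last (big_pred1 1%g) /=.
  by rewrite /des eq_card0 ?expr0 // => -[].
move=> s; rewrite !ord1 eqxx; apply/esym/eqP/permP => i.
by rewrite !ord1.
Qed.

(** The number of lattice points of the half-open cube [0,n)^(m-a) x [0,n]^a. *)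
Definition cube_count m a (n : nat) : R := n%:R ^+ (m - a) * n.+1%:R ^+ a.

Lemma cube_count_diff m b n : (b <= m)%N ->
  cube_count m b n = cube_count m.+1 b.+1 n - cube_count m.+1 b n.
Proof.
move=> bm; rewrite /cube_count subSS (subSn bm) !exprS -[n.+1]addn1 natrD.
by ring.
Qed.

Lemma sum_cube_count m a b n : (a <= b <= m.+1)%N ->
  \sum_(a <= i < b) cube_count m i n =
  cube_count m.+1 b n - cube_count m.+1 a n.
Proof.
move=> /andP[ab bm]; apply: (telescope_sumr_eq (fun i => cube_count m.+1 i n)) => // i /andP[_ ib].
by rewrite cube_count_diff // -ltnS (leq_trans ib).
Qed.

Lemma eulerian_lastP m a : (a <= m)%N -> forall n,
  cauchy ((1 - 'X) ^+ m.+1) (cube_count m a) n = (eulerian_last m a)`_n.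
Proof.
elim: m a => [|m IH] a am n.
  move: am; rewrite leqn0 => /eqP->.
  rewrite eulerian_last0 expr1 cauchyB1X coef1.
  by rewrite /cube_count !expr0 mulr1; case: n => [|n]; rewrite ?subr0 ?subrr.
rewrite eulerian_lastS// coef_sum exprSr cauchyM.
(* One factor 1 - X suffices to match the recurrence. The letters b < a telescope to
   [cube_count m.+1 a n] - n^(m+1); the letters b >= a carry a factor X, are evaluated at n - 1 and
   telescope to n^(m+1) minus the value of [cube_count m.+1 a] at n - 1. *)
transitivity (cauchy ((1 - 'X) ^+ m.+1)
  (fun k => \sum_(b < m.+1) cauchy 'X^(a <= b)%N (cube_count m b) k) n).
  apply: eq_cauchy => {}n; rewrite cauchyB1X.
  rewrite -(big_mkord predT (fun b => cauchy 'X^(a <= b)%N (cube_count m b) n)).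
  rewrite (@big_cat_nat _ _ _ a) //=.
  rewrite (eq_big_nat _ _ (F2 := fun b => cube_count m b n)); last first.
    by move=> b /andP[_ ba]; rewrite leqNgt ba cauchy1.
  rewrite sum_cube_count ?am// -addrA; congr (_ + _).
  rewrite (eq_big_nat _ _
    (F2 := fun b => if n is k.+1 then cube_count m b k else 0)); last first.
    by move=> b /andP[-> _]; rewrite cauchyX.
  case: n => [|n].
    by rewrite big1_eq addr0 /cube_count subn0 expr0n mul0r.
  rewrite sum_cube_count ?am ?leqnn // /cube_count subnn subn0 !expr0 mulr1 mul1r.
  by rewrite addrA addNr sub0r.
rewrite cauchy_sum; apply: eq_bigr => b _.
rewrite cauchyC coefM; apply: eq_bigr => i _.
by rewrite IH // -ltnS.
Qed.
End Eulerian.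

(** * The Eulerian vectors as a basis *)

Section EulerianVectors.
Variables (R : realType) (d : nat).

Lemma des_le m (s : 'S_m.+1) : (des s <= m)%N.
Proof. by rewrite /des (leq_trans (max_card _)) ?card_ord. Qed.

Lemma eulerianA_last (i : 'I_d.+1) :
  eulerianA R d i.+1 = eulerian_last R d (d - i).
Proof.
apply: eq_bigl => s; have := ltn_ord i; rewrite addn1 subSS ltnS => id.
by rewrite subSn // eqSS.
Qed.

Lemma size_eulerianA j : (size (eulerianA R d j) <= d.+1)%N.
Proof.
apply: (leq_trans (size_sum _ _ _)); apply/bigmax_leqP => s _.
by rewrite size_polyXn ltnS des_le.
Qed.

Lemma rVpoly_eulerian_vec j : rVpoly (eulerian_vec R d j) = eulerianA R d j.
Proof.
apply/polyP => n; case: (ltnP n d.+1) => nd.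
  by rewrite (coef_rVpoly_ord _ (Ordinal nd)) mxE.
by rewrite nth_default ?(leq_trans (size_poly _ _)) // nth_default //
   (leq_trans (size_eulerianA j)).
Qed.

(* The coefficients of the h*-polynomial in the basis A_1, ..., A_(d+1) are
   those of the Ehrhart polynomial in the basis n^i (n+1)^(d-i). *)
Lemma cauchy_ehrhart (c : 'I_d.+1 -> R) (f : nat -> R) :
  (forall n, f n = \sum_i c i * (n%:R ^+ i * n.+1%:R ^+ (d - i))) ->
  forall n, cauchy ((1 - 'X) ^+ d.+1) f n =
    (rVpoly (\sum_i c i *: eulerian_vec R d i.+1))`_n.
Proof.
move=> fE n; rewrite (eq_cauchy _ fE) cauchy_sum linear_sum coef_sum.
apply: eq_bigr => i _; rewrite linearZ /= coefZ rVpoly_eulerian_vec cauchyZ.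
rewrite eulerianA_last -eulerian_lastP ?leq_subr//; congr (_ * _).
apply: eq_cauchy => m; rewrite /cube_count subKn //.
by rewrite -ltnS.
Qed.

(** A linear relation v makes the sum of v_i n^i (n+1)^(d-i) vanish for all n. Divided by (n+1)^d,
    it says that the polynomial with coefficients v, of degree at most d, has the d + 1 distinct
    roots n/(n+1), 0 <= n <= d. *)
Lemma eulerian_row_free : row_free (\matrix_(i < d.+1) eulerian_vec R d i.+1).
Proof.
apply: inj_row_free => v vA.
pose f n : R := \sum_(i < d.+1) v 0 i * (n%:R ^+ i * n.+1%:R ^+ (d - i)).
have f0 : forall n, f n = 0.
  apply: (@cauchy_B1X_inj _ d.+1) => n.
  rewrite (@cauchy_ehrhart (v 0))//.
  suff -> : \sum_i v 0 i *: eulerian_vec R d i.+1 = 0 by rewrite linear0 coef0.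
  rewrite -[RHS]vA mulmx_sum_row; apply: eq_bigr => i _.
  by rewrite rowK.
pose rs := [seq n%:R / n.+1%:R : R | n <- iota 0 d.+1].
have rv n : root (rVpoly v) (n%:R / n.+1%:R).
  apply/eqP; apply: (@mulfI _ (n.+1%:R ^+ d)).
    by rewrite expf_neq0 // pnatr_eq0.
  rewrite mulr0 -(f0 n) (horner_coef_wide _ (size_poly _ _)) big_distrr.
  apply: eq_bigr => i _; rewrite /= coef_rVpoly_ord mulrCA; congr (_ * _).
  have id : (i <= d)%N by rewrite -ltnS.
  rewrite expr_div_n mulrCA; congr (_ * _).
  by rewrite -{1}(subnK id) exprD mulfK // expf_neq0 // pnatr_eq0.
have : rVpoly v = 0.
  apply: (@roots_geq_poly_eq0 _ _ rs).
  - by apply/allP => x /mapP[n _ ->].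
  - rewrite map_inj_uniq ?iota_uniq // => a b /eqP.
    rewrite eqr_div ?pnatr_eq0 // -!natrM eqr_nat !mulnS => /eqP; lia.
  - by rewrite size_map size_iota size_poly.
by move=> /(congr1 (@poly_rV R d.+1)); rewrite rVpolyK linear0.
Qed.

End EulerianVectors.

(** * Cardinality by explicit bijection *)

Section Counting.

(** A bijection with ['I_m] carries finiteness along with the cardinality; [fset_set] needs it,
    being empty on infinite sets. *)
Definition counted U (A : set U) m :=
  exists e : 'I_m -> U, injective e /\ A = range e.

Lemma finType_counted U (A : set U) (T : finType) (e : T -> U) :
  injective e -> (forall x, A x <-> exists t, x = e t) -> counted A #|T|.
Proof.
move=> ei eA; exists (fun i => e (enum_val i)); split.
  by move=> i j /ei /enum_val_inj.
apply/seteqP; split => [x /eA[t ->]|x [i _ <-]].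
  by exists (enum_rank t) => //; rewrite enum_rankK.
by apply/eA; exists (enum_val i).
Qed.

Lemma counted_image U U' (A : set U) (f : U -> U') m : injective f ->
  counted A m -> counted (f @` A) m.
Proof.
move=> fi [e [ei ->]]; exists (f \o e); split; first exact: inj_comp.
by apply/seteqP; split=> [x [_ [i _ <-] <-]|x [i _ <-]] /=;
   [exists i|exists (e i) => //; exists i].
Qed.

Lemma counted_fset (U : choiceType) (A : set U) m : counted A m ->
  #|` fset_set A| = m.
Proof.
move=> [e [ei ->]].
have -> : range e = [set` [fset e i | i : 'I_m]%fset].
  apply/seteqP; split => [x [i _ <-]|x /imfsetP[i _ ->]] /=; last by exists i.
  by apply/imfsetP; exists i.
by rewrite set_fsetK card_imfset //= -cardE card_ord.
Qed.

End Counting.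

(** * Lattice points of dilated zonotopes *)

Section LatticePoints.
Variable R : realType.
Local Notation toR := (map_mx (intr : int -> R)).

(* The lattice points of the k-th dilate of the zonotope with generators the
   rows of V. *)
Definition zonotope_pts n d (V : 'M[int]_(n, d)) (k : nat) : set 'rV[int]_d :=
  [set x | exists2 l : 'rV[R]_n,
     forall i, 0 <= l 0 i <= k%:R & toR x = l *m toR V].

Lemma toR_inj m n : injective (toR : 'M[int]_(m, n) -> 'M[R]_(m, n)).
Proof.
move=> A B /matrixP AB; apply/matrixP => i j.
by apply: (@intr_inj R); have := AB i j; rewrite !mxE.
Qed.

(** The translation contributes the integer vector k w to the k-th dilate, which does not affect the
    count. *)
Lemma ehrhart_zonotope n d (V : 'M[int]_(n, d)) w k m :
  counted (zonotope_pts V k) m -> ehrhart (zonotope (R := R) V w) k = m.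
Proof.
move=> Vm; apply: counted_fset.
pose f (x : 'rV[int]_d) : 'rV[R]_d := toR (x + w *+ k).
have fi : injective f by move=> x y /toR_inj /addIr.
suff -> : dilate k (zonotope V w) `&` @int_lattice R d =
    f @` zonotope_pts V k by exact: counted_image.
apply/seteqP; split => [x [[y [l l01 <-] <-] [z _ zE]]|_ [x [l lk xE] <-]].
  exists (z - w *+ k); last by rewrite /f subrK.
  exists (\row_i (k%:R * l i)).
    move=> i; rewrite mxE; have /andP[l0 l1] := l01 i.
    by rewrite mulr_ge0 // -{2}[k%:R]mulr1 ler_wpM2l.
  rewrite map_mxB zE scalerDr raddfMn /= scaler_nat addrAC subrr add0r.
  rewrite mulmx_sum_row scaler_sumr; apply: eq_bigr => i _.
  by rewrite mxE map_row scalerA.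
split; last by exists (x + w *+ k).
exists (toR w + \sum_i (l 0 i / k%:R) *: toR (row i V)).
  exists (fun i => l 0 i / k%:R) => // i; have /andP[l0 l1] := lk i.
  case: k l0 l1 {lk f fi xE Vm} => [|k] l0 l1; first by rewrite invr0 mulr0 lexx ler01.
  by rewrite divr_ge0 // ler_pdivrMr ?ltr0n // mul1r.
rewrite /f map_mxD xE raddfMn /= scalerDr scaler_nat addrC; congr (_ + _).
rewrite mulmx_sum_row scaler_sumr; apply: eq_bigr => i _.
rewrite scalerA map_row; congr (_ *: _).
(* For k = 0 the quotient l / k is 0 by convention, and the bounds force l = 0 as well. *)
have [k0|k0] := eqVneq (k%:R : R) 0; last by rewrite mulrC divfK.
by have := lk i; rewrite k0 mul0r => /le_anti ->.
Qed.

Lemma zonotope_pts0 n d (V : 'M[int]_(n, d)) m :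
  counted (zonotope_pts V 0) m -> m = 1%N.
Proof.
move=> [e [ei eA]].
have H x : zonotope_pts V 0 x <-> x = 0.
  split=> [[l l0 xE]|->].
    apply: toR_inj; rewrite xE map_mx0; suff -> : l = 0 by rewrite mul0mx.
    by apply/rowP => i; have := l0 i; rewrite mxE => /le_anti ->.
  by exists 0; [move=> i; rewrite mxE lexx | rewrite map_mx0 mul0mx].
have [i0 _ ei0] : range e 0 by rewrite -eA; apply/H.
have : forall i, i = i0.
  move=> i; apply: ei; rewrite ei0; apply/H; rewrite eA; by exists i.
case: m e ei eA i0 ei0 => [|[|m]] // _ _ _ []// j jm _ H'.
by have := H' ord_max; rewrite -(H' ord0).
Qed.

(** A unimodular change of coordinates permutes the lattice; it will serve to put a generator on the
    first axis. *)
Lemma zonotope_pts_unit n d (V : 'M[int]_(n, d)) (U : 'M[int]_d) k m :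
  U \in unitmx -> counted (zonotope_pts (V *m U) k) m ->
  counted (zonotope_pts V k) m.
Proof.
move=> Uu.
suff -> : zonotope_pts V k = (mulmx^~ (invmx U)) @` zonotope_pts (V *m U) k.
  by apply: counted_image => x y /(congr1 (mulmx^~ U)); rewrite !mulmxKV.
apply/seteqP; split => [x [l lk xE]|_ [x [l lk xE] <-]].
  exists (x *m U); last by rewrite mulmxK.
  by exists l => //; rewrite !map_mxM xE mulmxA.
exists l => //; rewrite map_mxM xE map_mxM mulmxA -mulmxA -map_mxM mulmxV //.
by rewrite map_mx1 mulmx1.
Qed.

(** A crude bound, the sum of all absolute values of entries; it makes the half-open parallelepiped
    finite and later bounds the fibres. *)
Lemma zonotope_pts_bounded n d (V : 'M[int]_(n, d)) :
  exists B : nat, forall (l : 'rV[R]_n) (k : R),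
    (forall i, 0 <= l 0 i <= k) -> forall j, `|(l *m toR V) 0 j| <= k * B%:R.
Proof.
exists (\sum_i \sum_j `|V i j|)%N => l k lk j.
rewrite mxE (le_trans (ler_norm_sum _ _ _)) // natr_sum big_distrr /=.
apply: ler_sum => i _; have /andP[l0 l1] := lk i.
rewrite normrM mxE (ger0_norm l0) ler_pM // natr_sum (bigD1 j) //=.
rewrite natr_absz intr_norm lerDl sumr_ge0 // => *; exact: ler0n.
Qed.

(** These are the possible integer parts over one point of the half-open parallelepiped: where its
    coordinate is nonzero (the predicate p) the value k is excluded. *)
Lemma card_box d k (p : pred 'I_d) :
  #|[pred f : {ffun 'I_d -> 'I_k.+1} | [forall i, p i ==> (f i < k)%N]]| =
  (k ^ #|p| * k.+1 ^ (d - #|p|))%N.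
Proof.
transitivity #|family (fun i => [pred y : 'I_k.+1 | p i ==> (y < k)%N])|.
  by apply: eq_card => f; rewrite !inE.
rewrite card_family foldrE big_map big_enum /=.
rewrite (bigID p) /=; congr (_ * _)%N.
  under eq_bigr => i pi.
    have -> : #|[pred y : 'I_k.+1 | p i ==> (y < k)%N]| = k.
      rewrite pi -[RHS]/k.+1.-1 -[in RHS](card_ord k.+1).
      rewrite -(cardC1 (ord_max : 'I_k.+1)); apply: eq_card => y.
      by rewrite !inE -val_eqE /= ltn_neqAle -ltnS ltn_ord andbT.
    over.
  by rewrite prod_nat_const.
under eq_bigr => i pi.
  have -> : #|[pred y : 'I_k.+1 | p i ==> (y < k)%N]| = k.+1.
    by rewrite -[RHS]card_ord; apply: eq_card => y; rewrite !inE (negbTE pi).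
  over.
rewrite prod_nat_const; congr (_ ^ _)%N.
apply/eqP; rewrite -(eqn_add2l #|p|) subnKC; last first.
  by rewrite -[leqRHS](card_ord d) max_card.
apply/eqP; rewrite -[RHS](card_ord d) -(cardC p); congr (_ + _)%N.
Qed.

(* The points q t are the lattice points of the half-open parallelepiped;
   every lattice point of the dilate is one of them plus a unique integer
   combination of the generators, read off the integer parts of the
   coordinates. *)
Lemma parallelepiped_pts d (V : 'M[int]_d) (T : finType)
    (q : T -> 'rV[int]_d) (mu : T -> 'rV[R]_d) :
  row_free (toR V) -> injective q ->
  (forall t, toR (q t) = mu t *m toR V) ->
  (forall t i, 0 <= mu t 0 i < 1) ->
  (forall (x : 'rV[int]_d) (l : 'rV[R]_d), toR x = l *m toR V ->
    (forall i, 0 <= l 0 i < 1) -> exists t, x = q t) ->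
  forall k, counted (zonotope_pts V k)
    (\sum_t (k ^ #|[pred i | mu t 0%R i != 0%R]| *
             k.+1 ^ (d - #|[pred i | mu t 0%R i != 0%R]|)))%N.
Proof.
move=> Vf qi qV mu01 qP k.
pose Q := [pred p : T * {ffun 'I_d -> 'I_k.+1} |
  [forall i, (mu p.1 0 i != 0) ==> (p.2 i < k)%N]].
have -> : (\sum_t (k ^ #|[pred i | mu t 0%R i != 0%R]| *
           k.+1 ^ (d - #|[pred i | mu t 0%R i != 0%R]|)) = #|{: {p | Q p}}|)%N.
  rewrite card_sig -sum1_card.
  rewrite (eq_bigl (fun p => predT p.1 && Q (p.1, p.2))); last by case.
  rewrite -(pair_big_dep predT (fun t f => Q (t, f)) (fun _ _ => 1%N)) /=.
  by apply: eq_bigr => t _; rewrite -card_box sum1_card.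
pose e (p : T * {ffun 'I_d -> 'I_k.+1}) : 'rV[int]_d :=
  q p.1 + (\row_i (p.2 i : nat)%:Z) *m V.
have eE p : toR (e p) = (mu p.1 + \row_i (p.2 i)%:R) *m toR V.
  rewrite map_mxD qV map_mxM mulmxDl; congr (_ + _ *m _).
  by apply/rowP => i; rewrite !mxE.
apply: (@finType_counted _ _ _ (fun p : {p | Q p} => e (val p))).
  move=> [p Qp] [p' Qp'] /= /(congr1 toR).
  rewrite !eE => /(row_free_inj Vf) /rowP pp'.
  have fl t (f : {ffun 'I_d -> 'I_k.+1}) i :
      Num.floor ((mu t + \row_i (f i)%:R) 0 i) = (f i : nat)%:Z.
    apply/floor_def; rewrite !mxE; have /andP[m0 m1] := mu01 t i.
    by rewrite lerDr m0 /= rmorphD /= addrC ltrD2l.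
  have ff : p.2 = p'.2.
    apply/ffunP => i; apply: val_inj; apply/eqP; rewrite -eqz_nat; apply/eqP.
    by rewrite -(fl p.1) pp' fl.
  apply: val_inj => /=; case: p p' ff pp' {Qp Qp'} => [t f] [t' f'] /= -> pp'.
  congr (_, _); apply: qi; apply: toR_inj; rewrite !qV; congr (_ *m _).
  by apply/rowP => i; have := pp' i; rewrite !mxE => /addIr.
move=> x; split => [[l lk xE]|[[p Qp] ->]]; last first.
  exists (mu p.1 + \row_i (p.2 i)%:R); last exact: eE.
  move=> i; rewrite !mxE; have /andP[m0 m1] := mu01 p.1 i.
  rewrite addr_ge0 //=; have [->|mi] := eqVneq (mu p.1 0 i) 0.
    by rewrite add0r ler_nat -ltnS.
  have /forallP/(_ i) := Qp; rewrite mi /= => pk.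
  apply: (@le_trans _ _ (1 + (p.2 i)%:R)); first by rewrite lerD2r ltW.
  by rewrite nat1r ler_nat.
have fl0 i : (0 <= Num.floor (l 0 i))%R.
  by rewrite floor_ge0; have /andP[] := lk i.
have flk i : (`|Num.floor (l 0%R i)| < k.+1)%N.
  rewrite -ltz_nat gez0_abs // floor_lt_int.
  have /andP[_ lk'] := lk i; rewrite (le_lt_trans lk') //.
  by rewrite -pmulrn ltr_nat.
pose f : {ffun 'I_d -> 'I_k.+1} := [ffun i => Ordinal (flk i)].
have fE i : ((f i)%:R : R) = (Num.floor (l 0 i))%:~R.
  by rewrite ffunE /= natr_absz ger0_norm.
pose m : 'rV[R]_d := l - \row_i (f i)%:R.
have [||t xt] := qP (x - (\row_i (f i : nat)%:Z) *m V) m.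
- rewrite map_mxB xE map_mxM mulmxBl; congr (_ - _ *m _).
  by apply/rowP => i; rewrite !mxE.
- move=> i; rewrite !mxE fE subr_ge0 floor_le /= ltrBlDl.
  by have := floorD1_gt (l 0 i); rewrite rmorphD.
have mE : mu t = m.
  apply: (row_free_inj Vf); rewrite -qV -xt map_mxB xE map_mxM mulmxBl.
  by congr (_ - _ *m _); apply/rowP => i; rewrite !mxE.
(* A nonzero fractional part puts the floor strictly below l <= k. *)
have Qp : Q (t, f).
  apply/forallP => i /=; apply/implyP; rewrite mE !mxE fE subr_eq0 => nl.
  rewrite -(ltr_nat R) fE lt_neqAle.
  have /andP[_ lk'] := lk i.
  have fl' := floor_le (l 0 i).
  rewrite (le_trans fl' lk') andbT; apply: contraNneq nl => fk.
  by rewrite eq_le fl' andbT fk.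
exists (exist _ (t, f) Qp) => /=.
by rewrite /e /= -xt subrK.
Qed.

Lemma row_free_ehrhart d (V : 'M[int]_d) : row_free (toR V) ->
  exists c : 'I_d.+1 -> nat, forall k, counted (zonotope_pts V k)
    (\sum_j c j * (k ^ j * k.+1 ^ (d - j)))%N.
Proof.
move=> Vf; have [B VB] := zonotope_pts_bounded V.
pose Q (x : 'rV[int]_d) :=
  exists2 l : 'rV[R]_d, (forall i, 0 <= l 0 i < 1) & toR x = l *m toR V.
(* Shifting by B enumerates the box [-B, B]^d, which contains the half-open parallelepiped. *)
pose q (y : {ffun 'I_d -> 'I_(B + B).+1}) : 'rV[int]_d :=
  \row_i ((y i : nat)%:Z - B%:Z).
have qi : injective q.
  move=> y y' /rowP yy; apply/ffunP => i; apply: val_inj.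
  by have := yy i; rewrite !mxE => /addIr [].
pose T : finType := {y | `[< Q (q y) >]}.
have muP (t : T) := cid2 (asboolW (valP t)).
pose mu t := s2val (muP t).
have := @parallelepiped_pts d V T (fun t => q (val t)) mu Vf.
have H1 : injective (fun t : T => q (val t)) by move=> t t' /qi /val_inj.
have H2 t : toR (q (val t)) = mu t *m toR V by exact: (s2valP' (muP t)).
have H3 t i : 0 <= mu t 0 i < 1 by exact: (s2valP (muP t)).
move=> /(_ H1 H2 H3) H.
exists (fun j : 'I_d.+1 => #|[pred t : T | #|[pred i | mu t 0 i != 0]| == j :> nat]|) => k.
pose I (t : T) : 'I_d.+1 := inord #|[pred i | mu t 0 i != 0]|.
have IE t : I t = #|[pred i | mu t 0 i != 0]| :> nat.
  by rewrite inordK // ltnS -[leqRHS](card_ord d) max_card.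
have -> : (\sum_(j < d.+1) #|[pred t : T | #|[pred i | mu t 0%R i != 0%R]| == j :> nat]| *
           (k ^ j * k.+1 ^ (d - j)) = \sum_t (k ^ I t * k.+1 ^ (d - I t)))%N.
  rewrite (partition_big I predT) //=; apply: eq_bigr => j _.
  rewrite (eq_bigr (fun _ => k ^ j * k.+1 ^ (d - j))%N); last first.
    by move=> t /eqP <-.
  rewrite sum_nat_const; congr (_ * _)%N; apply: eq_card => t.
  by rewrite inE /= -IE -[RHS]/(I t == j) -val_eqE.
under eq_bigr do rewrite IE.
apply: H => x l xE l01.
have xB j : (`|x 0%R j| <= B)%N.
  rewrite -(ler_nat R) natr_absz intr_norm.
  have := VB l 1; rewrite -xE mul1r => /(_ _ j); rewrite mxE; apply.
  by move=> i; have /andP[-> /ltW ->] := l01 i.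
have yB j : (`|(x 0 j + B%:Z)%R| < (B + B).+1)%N by have := xB j; lia.
pose y : {ffun 'I_d -> 'I_(B + B).+1} := [ffun j => Ordinal (yB j)].
have yE : q y = x.
  by apply/rowP => j; rewrite !mxE ffunE /=; have := xB j; lia.
have Qy : `[< Q (q y) >] by apply/asboolP; rewrite yE; exists l.
by exists (exist _ y Qy).
Qed.

(** * Adding one generator: deletion and contraction *)

Lemma int_set_max (D : int -> Prop) (a0 B : int) :
  (forall a b, a <= b -> D b -> D a) -> D a0 -> (forall a, D a -> a <= B) ->
  exists h, forall a, D a <-> a <= h.
Proof.
move=> Dle Da0 DB.
have exP : exists n : nat, `[< D (a0 + n%:Z) >].
  by exists 0%N; apply/asboolP; rewrite addr0.
have bP (n : nat) : `[< D (a0 + n%:Z) >] -> (n <= `|B - a0|)%N.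
  by move=> /asboolP/DB; lia.
case: (ex_maxnP exP bP) => n /asboolP Dn nmax.
exists (a0 + n%:Z) => a; split => [Da|an]; last exact: Dle an Dn.
rewrite leNgt; apply/negP => an.
have : `[< D (a0 + `|a - a0|%:Z) >].
  by apply/asboolP; apply: Dle Da; lia.
by move=> /nmax; lia.
Qed.

(* Over a lattice point y of the contraction, the fibre of the deletion is an
   interval, and adding the generator (g, 0) prolongs it by k g; whatever
   the endpoints are, this adds exactly k g integers, those following the
   largest integer h y lying below some point of the fibre. *)
Lemma deletion_contraction n d (V : 'M[int]_(n, 1 + d)) (i : 'I_n) (g k : nat)
    m1 m2 : row i V = row_mx (g%:Z)%:M 0 ->
  counted (zonotope_pts (row' i V) k) m1 ->
  counted (zonotope_pts (rsubmx (row' i V)) k) m2 ->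
  counted (zonotope_pts V k) (m1 + m2 * (g * k)).
Proof.
move=> iV [e1 [e1i e1A]] [e2 [e2i e2A]].
set W := row' i V in e1A e2A.
(* The real fibre over y of the k-th dilate of the deletion, along the first axis. *)
pose F (y : 'rV[int]_d) (a : R) := exists2 l : 'rV[R]_n.-1,
  (forall j, 0 <= l 0 j <= k%:R) & row_mx a%:M (toR y) = l *m toR W.
have Fconv y a b c : F y a -> F y b -> a <= c <= b -> F y c.
  move=> Fa Fb /andP[ac cb].
  have [ab|ab] := eqVneq a b.
    by suff -> : c = a by []; apply/eqP; rewrite eq_le ac ab cb.
  have ab0 : 0 < b - a by rewrite subr_gt0 lt_neqAle ab (le_trans ac).
  case: Fa Fb => l lk aE [l' lk' bE].
  pose s := (c - a) / (b - a).
  have s0 : 0 <= s by apply: divr_ge0; [rewrite subr_ge0|exact: ltW].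
  have s1 : s <= 1 by rewrite ler_pdivrMr // mul1r lerD2r.
  exists ((1 - s) *: l + s *: l').
    move=> j; rewrite !mxE; have /andP[? ?] := lk j; have /andP[? ?] := lk' j.
    by apply/andP; split; nra.
  rewrite mulmxDl -!scalemxAl -aE -bE !scale_row_mx add_row_mx -scalerDl subrK.
  rewrite scale1r.
  congr row_mx; apply/rowP => j; rewrite !mxE ord1 eqxx !mulr1n /s.
  by field; rewrite gt_eqF.
have ptsW a y : zonotope_pts W k (row_mx a%:M y) <-> F y a%:~R.
  by rewrite /zonotope_pts /= map_row_mx map_scalar_mx.
(* Adding the generator (g, 0) replaces the fibre by its Minkowski sum with [0, k g]. *)
have ptsV a y : zonotope_pts V k (row_mx a%:M y) <->
    exists2 s, 0 <= s <= k%:R & F y (a%:~R - s * g%:R).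
  have rE (l : 'rV[R]_n) : l *m toR V = l 0 i *: row_mx g%:R%:M 0 +
      (\row_j l 0 (lift i j)) *m toR W.
    rewrite mulmx_sum_row (bigD1_ord i) //=; congr (_ *: _ + _).
      by rewrite -map_row iV map_row_mx map_mx0 map_scalar_mx.
    rewrite mulmx_sum_row; apply: eq_bigr => j _; rewrite mxE.
    by congr (_ *: _); apply/rowP => c; rewrite !mxE.
  rewrite /zonotope_pts /= map_row_mx map_scalar_mx; split.
    move=> [l lk lE]; exists (l 0 i) => //.
    exists (\row_j l 0 (lift i j)); first by move=> j; rewrite mxE.
    move: lE; rewrite rE => /esym/(canRL (addKr _)) ->.
    rewrite scale_row_mx scaler0 opp_row_mx add_row_mx oppr0 add0r; congr row_mx.
    by apply/rowP => j; rewrite !mxE ord1 eqxx !mulr1n addrC.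
  move=> [s sk [l lk lE]].
  exists (\row_j (if unlift i j is Some j' then l 0 j' else s)).
    by move=> j; rewrite mxE; case: unlift.
  rewrite rE mxE unlift_none.
  have -> : \row_j (\row_j0 (if unlift i j0 is Some j' then l 0 j' else s)) 0
      (lift i j) = l by apply/rowP => j; rewrite !mxE liftK.
  rewrite -lE scale_row_mx scaler0 add_row_mx add0r; congr row_mx.
  by apply/rowP => j; rewrite !mxE ord1 eqxx !mulr1n addrC subrK.
have ptsC y : zonotope_pts (rsubmx W) k y <-> exists a, F y a.
  rewrite /zonotope_pts /= map_rsubmx; split => [[l lk yE]|[a [l lk yE]]].
    exists ((l *m lsubmx (toR W)) 0 0); exists l => //.
    rewrite -[toR W in RHS]hsubmxK mul_mx_row -yE; congr row_mx.
    by rewrite -mx11_scalar.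
  by exists l => //; rewrite mulmx_rsub -yE row_mxKr.
(* The fibre may contain no integer, so h is the largest integer below some point of it, not a
   maximum of the fibre. *)
have hP (j : 'I_m2) : exists h : int, forall a : int,
    (exists2 f, F (e2 j) f & a%:~R <= f) <-> a <= h.
  have [a0 Fa0] : exists a, F (e2 j) a.
    by apply/ptsC; rewrite e2A; exists j.
  have [B WB] := zonotope_pts_bounded W.
  apply: (@int_set_max _ (Num.floor a0) (k * B)%N%:Z).
  - move=> a b ab [f Ff bf]; exists f => //; apply: le_trans bf.
    by rewrite ler_int.
  - by exists a0 => //; exact: floor_le.
  - move=> a [f [l lk lE] af]; rewrite -(ler_int R) (le_trans af) //.
    have := WB l k%:R lk (lshift d 0); rewrite -lE row_mxEl mxE eqxx mulr1n.
    by move=> /(le_trans (ler_norm _)); rewrite -natrM.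
have {hP}[h hP] := choice hP.
pose T : finType := ('I_m1 + 'I_m2 * 'I_(g * k))%type.
have -> : (m1 + m2 * (g * k))%N = #|T|.
  by rewrite card_sum card_prod !card_ord.
pose e (t : T) : 'rV[int]_(1 + d) := match t with
  | inl j => e1 j
  | inr (j, r) => row_mx (h j + 1 + (r : nat)%:Z)%:M (e2 j)
  end.
have hF j (a : int) : F (e2 j) a%:~R -> a <= h j.
  by move=> Fa; apply/hP; exists a%:~R.
have row_mx1_inj (a b : int) (y z : 'rV[int]_d) :
    row_mx a%:M y = row_mx b%:M z -> a = b /\ y = z.
  move=> /eq_row_mx[/rowP/(_ 0)]; rewrite !mxE eqxx !mulr1n => -> ->.
  by [].
have e12 j r j' : e1 j' <> e (inr (j, r)).
  move=> /= E; have : zonotope_pts W k (e1 j') by rewrite e1A; exists j'.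
  by rewrite E => /ptsW/hF; lia.
apply: (@finType_counted _ _ _ e).
  move=> [j|[j r]] [j'|[j' r']].
  - by move=> /= /e1i ->.
  - by move=> /e12.
  - by move=> /esym/e12.
  - move=> /= /row_mx1_inj[+ /e2i jj]; rewrite jj => /addrI [rr].
    by congr (inr (_, _)); apply: val_inj.
move=> x; rewrite -(hsubmxK x) (mx11_scalar (lsubmx x)).
move: (lsubmx x 0 0) (rsubmx x) => a y {x}; split.
  move=> /ptsV[s /andP[s0 sk] Fs].
  have [j _ jy] : range e2 y by rewrite -e2A; apply/ptsC; exists (a%:~R - s * g%:R).
  (* If a <= h, then a lies between a - s g and another point of the fibre, hence in it by
     convexity. Otherwise a - g k <= a - s g gives a - g k <= h < a. *)
  rewrite -jy in Fs *; case: (leP a (h j)) => ah.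
    have /hP[f Ff af] := ah.
    have /ptsW : F (e2 j) a%:~R.
      by apply: Fconv Fs Ff _; rewrite af andbT gerBl mulr_ge0.
    by rewrite e1A => -[j' _ <-]; exists (inl j').
  have akg : a - (g * k)%N%:Z <= h j.
    apply/hP; exists (a%:~R - s * g%:R) => //.
    by rewrite rmorphB /= lerD2l lerN2 -pmulrn natrM mulrC ler_wpM2l.
  have rk : (`|(a - h j - 1)%R| < g * k)%N by move: ah akg; lia.
  by exists (inr (j, Ordinal rk)) => /=; congr (row_mx _%:M _); move: ah; lia.
move=> [[j|[j r]] /= E].
  apply/ptsV; exists 0; first by rewrite lexx /=.
  by rewrite mul0r subr0; apply/ptsW; rewrite E e1A; exists j.
move: E => /row_mx1_inj[-> ->]; apply/ptsV.
(* The existence of an index r < g k excludes g = 0. *)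
have g0 : (0 < g%:R :> R) by rewrite ltr0n; case: (g) r => [[]|].
(* As b - g k <= h < b, some f in the fibre satisfies b - g k <= f < b, and s = (b - f) / g lies in
   [0, k]. *)
set b := h j + 1 + _.
have /hP[f Ff bf] : b - (g * k)%N%:Z <= h j by rewrite /b; have := ltn_ord r; lia.
have fb : f < b%:~R.
  rewrite ltNge; apply/negP => bf'.
  by have /hP : exists2 f, F (e2 j) f & b%:~R <= f by [exists f]; rewrite /b; lia.
exists ((b%:~R - f) / g%:R); last by rewrite divfK ?gt_eqF // subKr.
apply/andP; split; first by apply: divr_ge0; [rewrite subr_ge0 ltW|exact: ltW].
rewrite ler_pdivrMr // lerBlDl -lerBlDr.
by move: bf; rewrite rmorphB /= -pmulrn natrM mulrC.
Qed.

(** Smith normal form of a single row, the sign of its entry being absorbed into U; v = 0 is allowed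
    and gives g = 0. *)
Lemma row_smith d (v : 'rV[int]_(1 + d)) :
  exists (U : 'M[int]_(1 + d)) (g : nat),
    U \in unitmx /\ v *m U = row_mx (g%:Z)%:M 0.
Proof.
have [L _ [U Uu [s _ ->]]] := int_Smith_normal_form v.
pose c := L 0 0 * s`_0.
have cE : L *m (\matrix_(i < 1, j < 1 + d) (s`_i *+ (i == j :> nat))) *m U *m
    invmx U = row_mx c%:M 0.
  rewrite mulmxK // (mx11_scalar L) mul_scalar_mx; apply/rowP => j.
  rewrite -[j]splitK; case: (split j) => [j'|j'] /=.
    by rewrite row_mxEl !mxE ord1 /= !mulr1n.
  by rewrite row_mxEr !mxE /= mulr0n mulr0.
case: (leP 0 c) => c0.
  by exists (invmx U), `|c|%N; rewrite unitmx_inv Uu cE gez0_abs.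
exists ((-1) *: invmx U), `|c|%N; rewrite unitmxZ ?unitrN1 // unitmx_inv Uu.
split=> //; rewrite -scalemxAr cE scale_row_mx scaler0 scale_scalar_mx mulN1r.
by rewrite ltz0_abs.
Qed.

Lemma row'M m n p (A : 'M[int]_(m, n)) (B : 'M[int]_(n, p)) i :
  row' i (A *m B) = row' i A *m B.
Proof.
by apply/matrixP => a b; rewrite !mxE; apply: eq_bigr => j _; rewrite mxE.
Qed.

Lemma zonotope_ehrhart n d (V : 'M[int]_(n, d)) : row_full (toR V) ->
  exists c : 'I_d.+1 -> nat, forall k, counted (zonotope_pts V k)
    (\sum_j c j * (k ^ j * k.+1 ^ (d - j)))%N.
Proof.
elim: n d V => [|n IH] d V Vfull.
  case: d V Vfull => [|d] V; last first.
    by rewrite /row_full; have := rank_leq_row (toR V); case: mxrank.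
  by move=> _; apply: row_free_ehrhart; rewrite flatmx0 /row_free mxrank0.
have [Vfree|/row_freePn[i iV]] := boolP (row_free (toR V)).
  have nd : n.+1 = d by rewrite -(eqP Vfree) (eqP Vfull).
  by case: d / nd V Vfull Vfree => V _; exact: row_free_ehrhart.
case: d V Vfull iV => [|d] V Vfull iV.
  exists (fun=> 1%N) => k; rewrite big_ord1 !expn0.
  exists (fun=> 0); split; first by move=> x y _; rewrite !ord1.
  apply/seteqP; split => [x _|_ [_ _ <-]] /=.
    by exists ord0; rewrite // thinmx0.
  exists 0; first by move=> j; rewrite mxE lexx ler0n.
  by rewrite map_mx0 mul0mx.
have [U [g [Uu vU]]] := row_smith (row i V).
(* Row i depends on the other rows, so its deletion preserves the span. *)
have Vi : row_full (toR (row' i V)).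
  apply/row_fullP; have /row_fullP[B BV] := Vfull.
  have : (1%:M <= toR (row' i V))%MS.
    rewrite -BV (submx_trans (submxMl _ _)) //; apply/row_subP => j.
    rewrite map_row'; case: (unliftP i j) => [j' ->|-> //].
    by rewrite (_ : row _ _ = row j' (row' i (toR V))) ?row_sub //;
       apply/rowP => c; rewrite !mxE.
  by move=> /submxP[C CE]; exists C.
have Wfull : row_full (toR (row' i (V *m U))).
  rewrite row'M map_mxM; have /row_fullP[B BV] := Vi; apply/row_fullP.
  exists (toR (invmx U) *m B); rewrite mulmxA -(mulmxA _ B) BV mulmx1.
  by rewrite -map_mxM mulVmx // map_mx1.
have Cfull : row_full (toR (rsubmx (row' i (V *m U)) : 'M_(n, d))).
  have /row_fullP[B BV] := Wfull; apply/row_fullP.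
  (* The lower right block of the identity B W = 1 gives a left inverse for the contraction. *)
  exists (dsubmx (B : 'M_(1 + d, n))); rewrite map_rsubmx mul_dsub_mx mulmx_rsub.
  by apply/matrixP => a b; rewrite BV !mxE (inj_eq (@rshift_inj _ _)).
have [c1 c1P] := IH _ _ Wfull.
have [c2 c2P] := IH _ _ Cfull.
(* Multiplying k^j (k+1)^(d-j), from the contraction in dimension d, by g k gives g times the basis
   element of index j + 1 in dimension d + 1. *)
exists (fun j =>
  c1 j + g * if unlift ord0 j is Some j' then c2 j' else 0)%N => k.
apply: (zonotope_pts_unit Uu).
have := @deletion_contraction _ d (V *m U) i g k _ _ _ (c1P k) (c2P k).
rewrite row_mul => /(_ vU); congr counted.
under [RHS]eq_bigr do rewrite mulnDl.
rewrite big_split /=; congr (_ + _)%N.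
rewrite [RHS]big_ord_recl unlift_none muln0 mul0n add0n big_distrl /=.
apply: eq_bigr => j _; rewrite liftK /= /bump /= add1n subSS expnS.
by nia.
Qed.

End LatticePoints.

(** * Dimension and uniqueness of the h*-vector *)

Section Dimension.
Variables (R : realType) (d : nat).
Local Notation toR := (map_mx (intr : int -> R)).

(** Affine combinations of points of the zonotope differ from w by combinations of the generators;
    conversely w and the points w + v_j affinely span everything once the generators span. *)
Lemma zonotope_has_dim n (V : 'M[int]_(n, d)) (w : 'rV[int]_d) :
  has_dim (zonotope (R := R) V w) d <-> row_full (toR V).
Proof.
split=> [[x0 [U [Ur AE]]]|Vfull].
  have Uf : row_full U by rewrite /row_full Ur.
  rewrite -sub1mx; apply/row_subP => j.
  have : affine_hull (zonotope (R := R) V w) (toR w + row j 1%:M).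
    rewrite AE; exists (toR w + row j 1%:M - x0); first exact: submx_full.
    by rewrite addrC subrK.
  move=> [m [a [p [pP a1 /(canRL (addKr _)) ->]]]].
  have -> : - toR w + \sum_i a i *: p i = \sum_i a i *: (p i - toR w).
    under [RHS]eq_bigr do rewrite scalerBr.
    by rewrite sumrB -scaler_suml a1 scale1r addrC.
  apply: summx_sub => i _; apply: scalemx_sub.
  have [l _ <-] := pP i; rewrite addrC addKr; apply: summx_sub => i' _.
  by apply: scalemx_sub; rewrite map_row row_sub.
exists 0, 1%:M; split; first by rewrite mxrank1.
apply/seteqP; split => [x _|x _] /=.
  by exists x; rewrite ?add0r //; apply: submx1.
have /submxP[mu muE] : (x - toR w <= toR V)%MS by exact: submx_full.
exists n.+1, (fun i => if unlift ord0 i is Some j then mu 0 j else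
  1 - \sum_j mu 0 j), (fun i => if unlift ord0 i is Some j then
  toR w + toR (row j V) else toR w); split.
- move=> i; case: unliftP => [j _|_].
    exists (fun i => (i == j)%:R).
      by move=> i'; case: eqP => _; rewrite ?lexx ?ler01.
    congr (_ + _); rewrite (bigD1 j) //= eqxx scale1r big1 ?addr0 // => i'.
    by move=> /negbTE ->; rewrite scale0r.
  exists (fun=> 0); first by move=> i'; rewrite lexx ler01.
  by rewrite big1 ?addr0 // => i' _; rewrite scale0r.
- rewrite big_ord_recl unlift_none.
  by under [X in _ + X]eq_bigr do rewrite liftK; rewrite subrK.
- rewrite big_ord_recl unlift_none.
  under [X in _ + X]eq_bigr do rewrite liftK scalerDr map_row.
  rewrite big_split /= -mulmx_sum_row -muE -scaler_suml addrA -scalerDl subrK.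
  by rewrite scale1r addrC subrK.
Qed.

(** The defining identity fixes every coefficient of h, so the one solution provided by the Eulerian
    expansion is the only one. *)
Lemma hstar_ehrhart (P : set 'rV[R]_d) (c : 'I_d.+1 -> nat) :
  (forall k, ehrhart P k = \sum_j c j * (k ^ j * k.+1 ^ (d - j)))%N ->
  forall h, is_hstar P h <-> h = \sum_i (c i)%:R *: eulerian_vec R d i.+1.
Proof.
move=> PE h.
have H := @cauchy_ehrhart R d (fun i => (c i)%:R) (fun n => (ehrhart P n)%:R) _.
have {}H : forall n, cauchy ((1 - 'X) ^+ d.+1) (fun n => (ehrhart P n)%:R) n =
    (rVpoly (\sum_i (c i)%:R *: eulerian_vec R d i.+1))`_n.
  apply: H => n; rewrite PE natr_sum; apply: eq_bigr => i _.
  by rewrite !natrM !natrX.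
split=> [hP|-> n]; last exact: H.
apply: (can_inj (@rVpolyK R d.+1)); apply/polyP => n.
by rewrite -H; apply/esym/hP.
Qed.

End Dimension.

(** * Parallelepipeds far out along each ray *)

Section Example.
Variables (R : realType) (d : nat) (j : 'I_d.+1) (N : nat).
Local Notation toR := (map_mx (intr : int -> R)).

(* The first generator is (N+1) e_0 - e_1 - ... - e_j and the others are unit
   vectors: the lattice points a e_0 (a <= N) of the half-open parallelepiped
   have coordinates a/(N+1) on the first j+1 generators and 0 elsewhere. *)
Definition example_mx : 'M[int]_d.+1 := \matrix_(i, l)
  if i == ord0 then if l == ord0 then N.+1%:Z else - (l <= j)%N%:Z
  else (i == l)%:Z.

Lemma mul_example_mx (l : 'rV[R]_d.+1) c : (l *m toR example_mx) 0 c =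
  if c == ord0 then l 0 ord0 * N.+1%:R else l 0 c - l 0 ord0 *+ (c <= j)%N.
Proof.
rewrite mxE (bigD1 ord0) //= !mxE eqxx; case: eqVneq => [->|c0].
  rewrite big1 ?addr0 ?pmulrn // => i /negbTE i0.
  by rewrite !mxE i0 mulr0.
rewrite (bigD1 c) //= big1 ?addr0 => [|i /andP[/negbTE i0 /negbTE ic]]; last first.
  by rewrite !mxE i0 ic mulr0.
rewrite !mxE (negbTE c0) eqxx mulr1 addrC rmorphN mulrN /=; congr (_ - _).
by case: (c <= j)%N; rewrite ?mulr1 ?mulr0.
Qed.

Lemma example_free : row_free (toR example_mx).
Proof.
apply: inj_row_free => v /rowP vE.
have v0 : v 0 ord0 = 0.
  have := vE ord0; rewrite mul_example_mx eqxx mxE => /eqP.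
  by rewrite mulf_eq0 pnatr_eq0 orbF => /eqP.
apply/rowP => c; have := vE c; rewrite mul_example_mx v0 mul0rn subr0 !mxE.
by case: eqVneq => [->|//].
Qed.

Lemma card_ord_le : #|[pred i : 'I_d.+1 | (i <= j)%N]| = j.+1.
Proof.
rewrite -sum1_card (eq_bigl (fun i : 'I_d.+1 => (i < j.+1)%N)) //.
by rewrite (big_ord_narrow (ltn_ord j)) sum1_card card_ord.
Qed.

(** The origin contributes the first term; each of the N other points has j + 1 nonzero coordinates
    and contributes k^(j+1) (k+1)^(d-j). *)
Lemma example_pts k : counted (zonotope_pts R example_mx k)
  (k.+1 ^ d.+1 + N * (k ^ j.+1 * k.+1 ^ (d.+1 - j.+1))).
Proof.
pose q (a : 'I_N.+1) : 'rV[int]_d.+1 :=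
  \row_c (if c == ord0 then (a : nat)%:Z else 0).
pose mu (a : 'I_N.+1) : 'rV[R]_d.+1 :=
  \row_c ((a%:R / N.+1%:R) *+ (c <= j)%N).
have N0 : (0 < N.+1%:R :> R) by rewrite ltr0n.
have := @parallelepiped_pts R _ example_mx 'I_N.+1 q mu example_free.
have H1 : injective q.
  move=> a b /rowP/(_ ord0); rewrite !mxE eqxx => -[]; exact: val_inj.
have H2 a : toR (q a) = mu a *m toR example_mx.
  apply/rowP => c; rewrite mul_example_mx !mxE; case: eqVneq => [//|c0].
    by rewrite divfK ?gt_eqF.
  by rewrite subrr.
have H3 a i : 0 <= mu a 0 i < 1.
  rewrite mxE; case: (i <= j)%N; rewrite ?mulr0n ?lexx ?ltr01 // mulr1n.
  by rewrite divr_ge0 //= ltr_pdivrMr // mul1r ltr_nat.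
move=> /(_ H1 H2 H3) H.
have -> : (k.+1 ^ d.+1 + N * (k ^ j.+1 * k.+1 ^ (d.+1 - j.+1)) = \sum_a
    (k ^ #|[pred i | mu a 0%R i != 0%R]| *
     k.+1 ^ (d.+1 - #|[pred i | mu a 0%R i != 0%R]|)))%N.
  rewrite big_ord_recl eq_card0 => [|i]; last first.
    by rewrite !inE mxE mul0r mul0rn eqxx.
  rewrite mul1n subn0; congr (_ + _)%N.
  rewrite -[N in LHS]card_ord -sum_nat_const; apply: eq_bigr => a _.
  rewrite (_ : #|[pred i | mu _ 0%R i != 0%R]| = j.+1) // -card_ord_le.
  apply: eq_card => i; rewrite !inE mxE; case: (i <= j)%N.
    by rewrite mulr1n mulf_neq0 // ?invr_neq0 // pnatr_eq0.
  by rewrite mulr0n eqxx.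
apply: H => x l xE l01.
have x0E : (x 0 ord0)%:~R = l 0 ord0 * N.+1%:R.
  by have /rowP/(_ ord0) := xE; rewrite mul_example_mx eqxx mxE.
have /andP[l0 l1] := l01 ord0.
have x0 : (0 <= x 0 ord0)%R by rewrite -(ler_int R) x0E mulr_ge0 // ltW.
have xN : (`|x 0%R ord0| < N.+1)%N.
  rewrite -(ltr_nat R) natr_absz ger0_norm // x0E -[ltRHS]mul1r.
  by rewrite ltr_pM2r.
exists (Ordinal xN); apply/rowP => c; rewrite mxE /=.
case: eqVneq => [->|c0]; first by rewrite gez0_abs.
have := congr1 (fun M : 'rV[R]__ => M 0 c) xE.
rewrite mul_example_mx (negbTE c0) mxE => xc.
have /andP[lc0 lc1] := l01 c.
(* Off the first axis, an integer coordinate strictly between -1 and 1 must be 0. *)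
have : (-1)%:~R < ((x 0 c)%:~R : R) < 1%:~R.
  by rewrite xc; case: (c <= j)%N; rewrite ?mulr1n ?mulr0n; apply/andP; split; lra.
by rewrite !ltr_int; lia.
Qed.

Lemma example_hstar : exists P : set 'rV[R]_d.+1,
  [/\ lattice_parallelepiped P, has_dim P d.+1 &
      is_hstar P (eulerian_vec R d.+1 1 + N%:R *: eulerian_vec R d.+1 j.+2)].
Proof.
exists (zonotope example_mx 0); split.
- by exists d.+1, example_mx, 0; split=> //; exact: example_free.
- apply/zonotope_has_dim; rewrite row_full_unit -row_free_unit.
  exact: example_free.
pose c (i : 'I_d.+2) : nat := if unlift ord0 i is Some i' then
  (N * (i' == j))%N else 1%N.
apply/(@hstar_ehrhart _ _ _ c).
  move=> k; rewrite (ehrhart_zonotope _ (example_pts k)).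
  rewrite big_ord_recl /c unlift_none mul1n subn0 mul1n; congr (_ + _)%N.
  rewrite (bigD1 j) //= liftK eqxx muln1 big1 ?addn0 // => i /negbTE ij.
  by rewrite liftK ij muln0.
rewrite big_ord_recl /c unlift_none scale1r; congr (_ + _).
rewrite (bigD1 j) //= liftK eqxx muln1 big1 ?addr0 // => i /negbTE ij.
by rewrite liftK ij muln0 scale0r.
Qed.

End Example.

(** * Convex sets and cones *)

Section Hulls.
Variables (R : realType) (k : nat).

Lemma convex_set_comb (A : set 'rV[R]_k) x y t : convex_set A ->
  A x -> A y -> 0 <= t -> t <= 1 -> A (t *: x + (1 - t) *: y).
Proof.
move=> cA Ax Ay t0 t1.
by have := cA x y (Itv01 t0 t1); rewrite !inE; apply.
Qed.

Lemma cone_at_convex n (a : 'rV[R]_k) (g : 'I_n -> 'rV[R]_k) :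
  convex_set (cone_at a g).
Proof.
move=> x y t; rewrite !inE => -[c c0 <-] [c' c'0 <-].
have t0 : 0 <= t%:num :> R by [].
have t1 : t%:num <= 1 :> R by [].
exists (fun i => t%:num * c i + (1 - t%:num) * c' i).
  by move=> i; rewrite addr_ge0 // mulr_ge0 // subr_ge0.
transitivity (t%:num *: (a + \sum_i c i *: g i) +
  (1 - t%:num) *: (a + \sum_i c' i *: g i)); last by [].
rewrite !scalerDr addrACA -scalerDl subrKC scale1r; congr (_ + _).
rewrite !scaler_sumr -big_split; apply: eq_bigr => i _ /=.
by rewrite [LHS]scalerDl !scalerA.
Qed.

(** Real points of a ray are interpolated between the apex and a far integer multiple; sums of
    directions are then reached by midpoints. *)
Lemma cone_at_sub_convex n (a : 'rV[R]_k) (g : 'I_n -> 'rV[R]_k) A :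
  convex_set A -> A a ->
  (forall i (N : nat), A (a + N%:R *: g i)) -> cone_at a g `<=` A.
Proof.
move=> cA Aa Ag.
have ray i c : 0 <= c -> A (a + c *: g i).
  move=> c0; pose N := (Num.truncn c).+1.
  have N0 : (0 < N%:R :> R) by rewrite ltr0n.
  have cN : c <= N%:R by rewrite ltW // /N truncnS_gt.
  have -> : a + c *: g i = (c / N%:R) *: (a + N%:R *: g i) + (1 - c / N%:R) *: a.
    rewrite scalerDr scalerA divfK ?gt_eqF // addrAC -scalerDl.
    by rewrite subrKC scale1r.
  apply: convex_set_comb => //; first by rewrite divr_ge0 // ltW.
  by rewrite ler_pdivrMr // mul1r.
move=> _ [c c0 <-].
(* The claim is for all c because each midpoint doubles the coefficients. *)
suff H (r : seq 'I_n) : forall c : 'I_n -> R, (forall i, 0 <= c i) ->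
    A (a + \sum_(i <- r) c i *: g i) by exact: H.
elim: r => [|i r IH] {c0}c c0; first by rewrite big_nil addr0.
have -> : a + \sum_(i <- i :: r) c i *: g i =
    2^-1 *: (a + (2 * c i) *: g i) +
    (1 - 2^-1) *: (a + \sum_(i <- r) (2 * c i) *: g i).
  have -> : 1 - 2^-1 = 2^-1 :> R by lra.
  rewrite big_cons !scalerDr addrACA -scalerDl scalerA mulKf ?pnatr_eq0 //.
  have -> : 2^-1 + 2^-1 = 1 :> R by lra.
  rewrite scale1r; congr (_ + (_ + _)); rewrite scaler_sumr.
  by apply: eq_bigr => i' _; rewrite scalerA mulKf ?pnatr_eq0.
apply: convex_set_comb; rewrite ?invr_ge0 ?invf_le1 ?ler1n //.
  by apply: ray; rewrite mulr_ge0.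
by apply: IH => i'; rewrite mulr_ge0.
Qed.

End Hulls.

(** * The cone of h*-vectors *)

Lemma zonotope_hstar_cone (R : realType) (d : nat) (P : set 'rV[R]_d) h :
  lattice_zonotope P -> has_dim P d -> is_hstar P h ->
  cone_at (eulerian_vec R d 1) (fun i : 'I_d => eulerian_vec R d i.+2) h.
Proof.
move=> [n [V [w ->]]] /zonotope_has_dim Vfull.
have [c cP] := zonotope_ehrhart Vfull.
move=> /(hstar_ehrhart (fun k => ehrhart_zonotope w (cP k))) ->.
(* The Ehrhart polynomial is 1 at 0, which forces the coefficient of A_1. *)
have c0 : c ord0 = 1%N.
  have := zonotope_pts0 (cP 0%N); rewrite big_ord_recl big1 ?addn0 => [|i _].
    by rewrite expn0 exp1n !muln1.
  by rewrite exp0n // mul0n muln0.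
exists (fun i => (c (lift ord0 i))%:R); first by move=> i; exact: ler0n.
by rewrite big_ord_recl c0 scale1r.
Qed.

Theorem theorem1p3 (R : realType) (d : nat) (hd : (1 <= d)%N) :
  let Z : set 'rV[R]_d.+1 := hstar_hull (@lattice_zonotope R d) in
  let P : set 'rV[R]_d.+1 := hstar_hull (@lattice_parallelepiped R d) in
  let K : set 'rV[R]_d.+1 :=
    cone_at (eulerian_vec R d 1) (fun i : 'I_d => eulerian_vec R d i.+2) in
  [/\ Z = P,
      P = K,
      simplicial_cone d K &
      row_free (\matrix_(i < d.+1) eulerian_vec R d i.+1)].
Proof.
move=> Z P K.
have PZ : P `<=` Z.
  move=> h Ph A [cA ZA]; apply: Ph; split => // h' [Q [[n [v [w [_ QE]]]] Qd Qh]].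
  by apply: ZA; exists Q; split => //; exists n, v, w.
have ZK : Z `<=` K.
  move=> h; apply; split; first exact: cone_at_convex.
  by move=> h' [Q [QZ Qd Qh]]; exact: zonotope_hstar_cone Qh.
have KP : K `<=` P.
  move=> h Kh A [cA PA]; move: h Kh.
  case: d hd @Z @P @K PZ ZK A cA PA => // d _ _ _ K _ _ A cA PA.
  have ex (i : 'I_d.+1) (N : nat) :
      A (eulerian_vec R d.+1 1 + N%:R *: eulerian_vec R d.+1 i.+2).
    by apply: PA; exact: example_hstar.
  apply: cone_at_sub_convex => //.
  (* The apex is the case N = 0; an index exists since the dimension is positive. *)
  by have := ex ord0 0%N; rewrite scale0r addr0.
have free := eulerian_row_free R d.
split => //.
- by apply/seteqP; split => // h /ZK/KP.
- by apply/seteqP; split => // h /PZ/ZK.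
exists (eulerian_vec R d 1), (fun i : 'I_d => eulerian_vec R d i.+2); split => //.
apply: inj_row_free => v vE.
have /row_free_inj inj := free.
(* Padding v with coefficient 0 at A_1 reduces to the independence of all d + 1 vectors. *)
have : row_mx (0 : 'rV[R]_1) v = 0.
  apply: inj; rewrite mul0mx mulmx_sum_row big_ord_recl.
  have -> : row_mx (0 : 'rV[R]_1) v 0 ord0 = 0.
    by rewrite mxE; case: splitP => // i _; rewrite mxE.
  rewrite scale0r add0r -[RHS]vE mulmx_sum_row; apply: eq_bigr => i _.
  rewrite !rowK; congr (_ *: _); rewrite -[RHS](row_mxEr (0 : 'rV[R]_1)).
  by congr (fun_of_matrix _ _ _); apply: val_inj.
by rewrite -row_mx0 => /eq_row_mx[].
Qed.
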